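(* Let $H$ be a Hadamard manifold, $E\subseteq H$ a nonempty open geodesic convex set, $\psi_u:E\to\mathbb{R}$, $u\in\{1,\dots,t\}$, $F=\{p\in E:\psi_u(p)\le0,\ u=1,\dots,t\}$ and $\bar p\in F$. Let each $\psi_u$ be convex and directionally differentiable at $\bar p$ and let $\phi_s:E\to\mathbb{I}$ with $\phi_s(p)=[\phi_s^L(p),\phi_s^U(p)]$, $s\in\{1,\dots,l\}$, be LU-convex and weakly directionally differentiable at $\bar p$. Suppose there exist real numbers $\lambda_s>0$, $s\in\{1,\dots,l\}$, and $\mu_u\ge0$, $u\in\{1,\dots,t\}$, such that (i) $-\Big(\sum_{s=1}^{l}\lambda_s\phi_s'(\bar p;\exp_{\bar p}^{-1}p)\Big)\ominus_g\sum_{u=1}^{t}\mu_u\psi_u'(\bar p;\exp_{\bar p}^{-1}p)\leqq_{LU}[0,0]$ for all $p\in F$; (ii) $\mu_u\psi_u(\bar p)=0$, $u\in\{1,\dots,t\}$. Then $\bar p$ is a type-I Pareto optimal solution of the problem (MIVOP2) of minimizing $\phi=(\phi_1,\dots,\phi_l)$ over $F$.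
   Context: A Hadamard manifold $H$ is a complete simply connected Riemannian manifold of non-positive sectional curvature; for $p\in H$ the map $\exp_p:T_p(H)\to H$ is a diffeomorphism with inverse $\exp_p^{-1}$, and the geodesic joining $p$ to $q$ is $\gamma_{p,q}(\alpha)=\exp_p(\alpha\exp_p^{-1}q)$, $\alpha\in[0,1]$. A set $E\subseteq H$ is geodesic convex if $\gamma_{p,q}(\alpha)\in E$ for all $p,q\in E$, $\alpha\in[0,1]$. The feasible set $F$ is assumed geodesic convex. For $f:E\to\mathbb{R}$, the directional derivative is $f'(p;w)=\lim_{\alpha\to0^+}\frac{f(\exp_p(\alpha w))-f(p)}{\alpha}$, $w\in T_p(H)$; $f$ is directionally differentiable at $p$ if it exists (finite) for all $w\in T_p(H)$. $f$ is convex at $p\in E$ if $f(\gamma_{p,q}(\alpha))\le\alpha f(q)+(1-\alpha)f(p)$ for all $q\in E$, $\alpha\in[0,1]$. $\mathbb{I}$ is the set of closed bounded intervals of $\mathbb{R}$; a real number $a$ is regarded as $[a,a]$. For $T=[t^L,t^U]$, $S=[s^L,s^U]$: $T+S=[t^L+s^L,t^U+s^U]$; $kT=\{kx:x\in T\}$ for $k\in\mathbb{R}$, so $-T=[-t^U,-t^L]$; the generalized Hukuhara difference is $T\ominus_gS=[\min\{t^L-s^L,t^U-s^U\},\max\{t^L-s^L,t^U-s^U\}]$; the Hausdorff metric is $d_H(T,S)=\max\{|t^L-s^L|,|t^U-s^U|\}$. $T\leqq_{LU}S$ iff $t^L\le s^L$ and $t^U\le s^U$; $T<_{LU}S$ means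 $T\leqq_{LU}S$ and $T\ne S$. For tuples of intervals, $T<_{LU}S$ means $T_k\leqq_{LU}S_k$ for all $k$ and $T_h<_{LU}S_h$ for at least one $h$. $f=[f^L,f^U]:E\to\mathbb{I}$ is weakly directionally differentiable at $p$ if $f^L$ and $f^U$ are directionally differentiable at $p$; it is LU-convex at $p$ if $f(\gamma_{p,q}(\alpha))\leqq_{LU}(1-\alpha)f(p)+\alpha f(q)$ for all $q\in E$, $\alpha\in[0,1]$. The gH-directional derivative of $f$ at $p$ in direction $w\in T_p(H)$ is the interval $f'(p;w)=\lim_{\alpha\to0^+}\frac1\alpha\big(f(\exp_p(\alpha w))\ominus_gf(p)\big)$ (limit in $d_H$); it exists whenever $f$ is weakly directionally differentiable at $p$. In (i), $\phi_s'$ denotes the gH-directional derivative. $\bar p\in F$ is a type-I Pareto optimal solution of (MIVOP2) if there is no $\hat p\in F$ with $\phi(\hat p)<_{LU}\phi(\bar p)$. *)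

(* Defs.v *)
From HB Require Import structures.
From mathcomp Require Import all_boot all_order all_algebra.
From mathcomp Require Import all_classical all_reals all_analysis.

Set Implicit Arguments.
Unset Strict Implicit.
Unset Printing Implicit Defensive.

Import Order.TTheory GRing.Theory Num.Theory.
Import numFieldNormedType.Exports.

Local Open Scope classical_set_scope.
Local Open Scope ring_scope.

Section Smooth.
Context {R : realType} {V W : normedModType R}.

Fixpoint Ck (k : nat) (U : set V) (f : V -> W) : Prop :=
  match k with
  | 0%N => forall x, U x -> {for x, continuous f}
  | k'.+1 => (forall x, U x -> differentiable f x) /\
             forall v, Ck k' U ('D_v f)
  end.

Definition smooth_on (U : set V) (f : V -> W) : Prop := forall k, Ck k U f.

End Smooth.

(* The values of [chart_to] off [chart_dom] and of [chart_from] off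
   [chart_img] are irrelevant. *)
Record chart (R : realType) (n : nat) (M : topologicalType) := Chart {
  chart_dom : set M;
  chart_to : M -> 'rV[R]_n;
  chart_from : 'rV[R]_n -> M;
  chart_img := chart_to @` chart_dom;
  chart_dom_open : open chart_dom;
  chart_img_open : open chart_img;
  chart_toK : forall p, chart_dom p -> chart_from (chart_to p) = p;
  chart_to_continuous : forall p, chart_dom p -> {for p, continuous chart_to};
  chart_from_continuous :
    forall x, chart_img x -> {for x, continuous chart_from} }.

Definition transition (R : realType) (n : nat) (M : topologicalType)
    (c c' : chart R n M) : 'rV[R]_n -> 'rV[R]_n :=
  chart_to c' \o chart_from c.

(* The atlas is indexed by the points of the manifold: [chart_at p] is a chart
   around [p].  Every smooth structure is generated by such an atlas. *)
Record smoothManifold (R : realType) (n : nat) := SmoothManifold {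
  carrier :> topologicalType;
  manifold_hausdorff : hausdorff_space carrier;
  manifold_second_countable : @second_countable carrier;
  chart_at : carrier -> chart R n carrier;
  chart_at_mem : forall p, chart_dom (chart_at p) p;
  transition_smooth : forall a b,
    smooth_on (chart_to (chart_at a) @`
                 (chart_dom (chart_at a) `&` chart_dom (chart_at b)))
              (transition (chart_at a) (chart_at b)) }.

(* The tangent space at [p], through its coordinates in [chart_at p]. *)
Definition tangent (R : realType) (n : nat) (M : smoothManifold R n) (p : M) :=
  'rV[R]_n.

(* [g p] is the Gram matrix of an inner product on [tangent p], i.e. in the
   coordinates of [chart_at p]; [gram g a x] is the Gram matrix, in the
   coordinates of [chart_at a], of the inner product at the point of
   coordinates [x]. *)
Definition gram (R : realType) (n : nat) (M : smoothManifold R n)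
    (g : M -> 'M[R]_n) (a : M) (x : 'rV[R]_n) : 'M[R]_n :=
  let p := chart_from (chart_at a) x in
  let J := 'J (transition (chart_at a) (chart_at p)) x in
  J *m g p *m J^T.

Record riemannianManifold (R : realType) (n : nat) := RiemannianManifold {
  rmanifold :> smoothManifold R n;
  metric : rmanifold -> 'M[R]_n;
  metric_sym : forall p, (metric p)^T = metric p;
  metric_pos : forall p (v : 'rV[R]_n), v != 0 ->
    0 < (v *m metric p *m v^T) 0 0;
  metric_smooth : forall a i j,
    smooth_on (chart_img (chart_at a)) (fun x => gram metric a x i j) }.

Section RiemannianGeometry.
Context {R : realType} {n : nat} {M : riemannianManifold R n}.
Implicit Types (a p q : M) (x u v w : 'rV[R]_n) (i j k l m : 'I_n).

Definition partial i (f : 'rV[R]_n -> R) : 'rV[R]_n -> R :=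
  'D_(delta_mx 0 i) f.

Local Notation g := (gram (@metric R n M)).

(* Gamma^k_{ij} of the Levi-Civita connection in the chart at [a]. *)
Definition christoffel a k i j x : R :=
  2^-1 * \sum_l invmx (g a x) k l *
    (partial i (fun y => g a y j l) x + partial j (fun y => g a y i l) x
     - partial l (fun y => g a y i j) x).

(* R(d_i, d_j) d_k = \sum_l (curvature a l k i j) d_l, where
   R(X, Y) Z = nabla_X nabla_Y Z - nabla_Y nabla_X Z - nabla_[X,Y] Z. *)
Definition curvature a l k i j x : R :=
  partial i (christoffel a l j k) x - partial j (christoffel a l i k) x
  + \sum_m (christoffel a l i m x * christoffel a m j k x
            - christoffel a l j m x * christoffel a m i k x).

Definition inner a x u v : R := (u *m g a x *m v^T) 0 0.

Definition curvature_vec a x u v w : 'rV[R]_n :=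
  \row_l \sum_i \sum_j \sum_k u 0 i * v 0 j * w 0 k * curvature a l k i j x.

Definition sectional_curvature a x u v : R :=
  inner a x (curvature_vec a x u v v) u /
  (inner a x u u * inner a x v v - inner a x u v ^+ 2).

Definition nonpositive_curvature : Prop :=
  forall a x u v, chart_img (chart_at a) x -> row_free (col_mx u v) ->
    sectional_curvature a x u v <= 0.

Definition local_coord a (c : R -> M) i (t : R) : R :=
  chart_to (chart_at a) (c t) 0 i.

Definition is_geodesic (c : R -> M) : Prop :=
  continuous c /\
  forall a t, chart_dom (chart_at a) (c t) -> forall k,
    [/\ \forall s \near t, derivable (local_coord a c k) s 1,
        derivable (derive1 (local_coord a c k)) t 1 &
        derive1 (derive1 (local_coord a c k)) t =
          - \sum_i \sum_j
              christoffel a k i j (chart_to (chart_at a) (c t)) *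
              derive1 (local_coord a c i) t * derive1 (local_coord a c j) t].

Definition geodesic_from p (v : tangent p) (c : R -> M) : Prop :=
  [/\ is_geodesic c, c 0 = p & forall i, derive1 (local_coord p c i) 0 = v 0 i].

Definition geodesically_complete : Prop :=
  forall p (v : tangent p), exists c, geodesic_from v c.

(* Total when [M] is geodesically complete; the geodesic is unique. *)
Definition rexp p (v : tangent p) : M :=
  xget (fun=> p) (geodesic_from v) 1.

(* The inverse of [rexp]: on a Hadamard manifold exactly one [v] satisfies
   [rexp v = q], by the Cartan-Hadamard theorem. *)
Definition rlog p q : tangent p :=
  xget (0 : 'rV[R]_n) [set v | rexp (v : tangent p) = q].

Definition geodesic_arc p q (t : R) : M :=
  rexp (t *: rlog p q : tangent p).

End RiemannianGeometry.

Arguments nonpositive_curvature {R n} M.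
Arguments geodesically_complete {R n} M.
Arguments rexp {R n M} p v.

Definition path_connected (R : realType) (T : topologicalType) : Prop :=
  forall p q : T, exists c : R -> T,
    [/\ {within `[0, 1], continuous c}, c 0 = p & c 1 = q].

Definition loops_contractible (R : realType) (T : topologicalType) : Prop :=
  forall c : R -> T, {within `[0, 1], continuous c} -> c 0 = c 1 ->
    exists h : R * R -> T,
      {within `[0, 1] `*` `[0, 1], continuous h} /\
      forall t : R, 0 <= t <= 1 ->
        [/\ h (t, 0) = c t, h (t, 1) = c 0, h (0, t) = c 0 & h (1, t) = c 0].

Definition simply_connected (R : realType) (T : topologicalType) : Prop :=
  path_connected R T /\ loops_contractible R T.

Record hadamardManifold (R : realType) (n : nat) := HadamardManifold {
  hmanifold :> riemannianManifold R n;
  hadamard_complete : geodesically_complete hmanifold;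
  hadamard_simply_connected : simply_connected R hmanifold;
  hadamard_curvature : nonpositive_curvature hmanifold }.

Section Bint.
Context {R : realType}.

Definition bint := {x : R * R | x.1 <= x.2}.

HB.instance Definition _ := Choice.on bint.

Definition lo (T : bint) : R := (val T).1.
Definition hi (T : bint) : R := (val T).2.

Definition bint_set (T : bint) : set R := `[lo T, hi T].

Definition Bint (a b : R) (ab : a <= b) : bint := exist _ (a, b) ab.

Definition bint_of (a : R) : bint := Bint (lexx a).

Fact lo_le_hi (T : bint) : lo T <= hi T.
Proof. exact: (valP T). Qed.

Fact le_min_max (a b : R) : Num.min a b <= Num.max a b.
Proof. by rewrite ge_min le_max lexx. Qed.

Lemma bint_eqP (T S : bint) : lo T = lo S -> hi T = hi S -> T = S.
Proof.
case: T S => [[a b] ab] [[c d] cd]; rewrite /lo /hi /= => ac bd.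
by apply: val_inj; rewrite /= ac bd.
Qed.

Definition bint_add (T S : bint) : bint :=
  Bint (lerD (lo_le_hi T) (lo_le_hi S)).

Fact bint_addA : associative bint_add.
Proof. by move=> T S U; apply: bint_eqP; rewrite /lo /hi /= addrA. Qed.

Fact bint_addC : commutative bint_add.
Proof. by move=> T S; apply: bint_eqP; rewrite /lo /hi /= addrC. Qed.

Fact bint_add0 : left_id (bint_of 0) bint_add.
Proof. by move=> T; apply: bint_eqP; rewrite /lo /hi /= add0r. Qed.

HB.instance Definition _ :=
  GRing.isNmodule.Build bint bint_addA bint_addC bint_add0.

Definition bint_scale (k : R) (T : bint) : bint :=
  Bint (le_min_max (k * lo T) (k * hi T)).

Lemma bint_scaleE k T :
  bint_set (bint_scale k T) = [set k * x | x in bint_set T].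
Proof.
have Tle := lo_le_hi T.
rewrite /bint_set {1}/lo {1}/hi /=; apply/seteqP; split=> y /=; last first.
  case=> x; rewrite !in_itv /= => /andP[lx xh] <-.
  have [k0|/ltW k0] := leP 0 k.
    by rewrite ge_min le_max (ler_wpM2l k0 lx) (ler_wpM2l k0 xh) orbT.
  by rewrite ge_min le_max (ler_wnM2l k0 lx) (ler_wnM2l k0 xh) !orbT.
rewrite in_itv /=; have [->|k0] := eqVneq k 0.
  rewrite !mul0r minxx maxxx => /andP[y0 y1]; exists (lo T).
    by rewrite in_itv /= lexx.
  by rewrite mul0r; apply/eqP; rewrite eq_le y0 y1.
move=> yk; exists (k^-1 * y); last by rewrite mulVKf.
rewrite in_itv /= ![k^-1 * y]mulrC; move: k0 yk; rewrite neq_lt => /orP[k0|k0].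
  have kle := ler_wnM2l (ltW k0) Tle.
  rewrite min_r// max_l// => /andP[y0 y1].
  by rewrite ler_ndivlMr// ler_ndivrMr// ![_ * k]mulrC y0 y1.
have kle := ler_wpM2l (ltW k0) Tle.
rewrite min_l// max_r// => /andP[y0 y1].
by rewrite ler_pdivlMr// ler_pdivrMr// ![_ * k]mulrC y0 y1.
Qed.

Definition bint_opp (T : bint) : bint := bint_scale (-1) T.

Definition gHsub (T S : bint) : bint :=
  Bint (le_min_max (lo T - lo S) (hi T - hi S)).

Definition hausdorff_dist (T S : bint) : R :=
  Num.max `|lo T - lo S| `|hi T - hi S|.

Definition leLU (T S : bint) : bool := (lo T <= lo S) && (hi T <= hi S).
Definition ltLU (T S : bint) : bool := leLU T S && (T != S).

Definition ltLU_tuple (l : nat) (T S : 'I_l -> bint) : Prop :=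
  (forall k, leLU (T k) (S k)) /\ exists h, ltLU (T h) (S h).

End Bint.

Arguments bint R : clear implicits.

(* Functions on [E] are represented by functions on the whole manifold, whose
   values off [E] play no role: [E] is open in all uses, so that
   [rexp p (a *: w)] lies in [E] for [a] small. *)
Section Hadamard.
Context {R : realType} {n : nat} {H : hadamardManifold R n}.
Implicit Types (E F : set H) (p q : H).

Definition geodesic_convex E : Prop :=
  forall p q (t : R), E p -> E q -> 0 <= t <= 1 -> E (geodesic_arc p q t).

Definition dir_quotient (f : H -> R) p (w : tangent p) (a : R) : R :=
  (f (rexp p (a *: w)) - f p) / a.

Definition dir_derivative (f : H -> R) p (w : tangent p) : R :=
  lim (dir_quotient f w a @[a --> 0^'+]).

Definition dir_differentiable (f : H -> R) p : Prop :=
  forall w : tangent p, cvg (dir_quotient f w a @[a --> 0^'+]).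

Definition convex_at E (f : H -> R) p : Prop :=
  forall q (t : R), E q -> 0 <= t <= 1 ->
    f (geodesic_arc p q t) <= t * f q + (1 - t) * f p.

Definition weakly_dir_differentiable (f : H -> bint R) p : Prop :=
  dir_differentiable (lo \o f) p /\ dir_differentiable (hi \o f) p.

Definition LU_convex_at E (f : H -> bint R) p : Prop :=
  forall q (t : R), E q -> 0 <= t <= 1 ->
    leLU (f (geodesic_arc p q t))
         (bint_scale (1 - t) (f p) + bint_scale t (f q)).

Definition gH_quotient (f : H -> bint R) p (w : tangent p) (a : R) : bint R :=
  bint_scale a^-1 (gHsub (f (rexp p (a *: w))) (f p)).

Definition is_gH_dir_derivative (f : H -> bint R) p (w : tangent p)
    (D : bint R) : Prop :=
  hausdorff_dist (gH_quotient f w a) D @[a --> 0^'+] --> (0 : R).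

(* [bint_of 0] if the limit does not exist. *)
Definition gH_dir_derivative (f : H -> bint R) p (w : tangent p) : bint R :=
  xget (bint_of 0) (is_gH_dir_derivative f w).

Definition feasible_set E (t : nat) (psi : 'I_t -> H -> R) : set H :=
  [set p | E p /\ forall u, psi u p <= 0].

Definition type_I_Pareto_optimal (l : nat) (phi : 'I_l -> H -> bint R) F p :
    Prop :=
  F p /\ ~ exists2 q, F q & ltLU_tuple (phi^~ q) (phi^~ p).

End Hadamard.

(* Main.v *)
Require Import Defs.
From mathcomp Require Import all_boot all_order all_algebra.
From mathcomp Require Import all_classical all_reals all_analysis.
From mathcomp Require Import ring.
Import Order.TTheory GRing.Theory Num.Theory.
Import numFieldNormedType.Exports.
Local Open Scope classical_set_scope.
Local Open Scope ring_scope.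

(** A convex function [f] satisfies the gradient inequality
    [f'(p; exp_p^-1 q) <= f q - f p]: on the geodesic from [p] to [q],
    convexity bounds every difference quotient with step in ]0, 1] by
    [f q - f p], and the bound passes to the limit
    ([dir_derivative_le_sub]).

    The gH-directional derivative of an interval-valued function has the minimum
    and the maximum of the derivatives of the two endpoint functions as its
    endpoints, because the Hausdorff distance metrizes convergence of both
    endpoints ([gH_dir_derivativeE]).  Hence, if [q] does not do worse than
    [p] in an LU-convex objective, the lower end of the derivative towards [q]
    is nonpositive, and it is negative as soon as [q] does strictly better in
    one of the two endpoints ([lo_gH_dir_derivative_le0],
    [lo_gH_dir_derivative_lt0]).

    For an interval [T] and a number [c], the relation
    [(- T) gH- c <=_LU 0] amounts to [- c <= lo T] ([leLU_gHsub_opp]).  The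
    stationarity condition therefore bounds below the sum of the lower ends,
    weighted by the [lambda_s], by [- \sum_u mu_u psi_u'], which is
    nonnegative towards a feasible [q]: by the gradient inequality and
    complementary slackness, [mu_u psi_u' <= mu_u psi_u q <= 0].
    A feasible point dominating [pbar] would make the same weighted sum
    negative, the weights [lambda_s] being positive. *)

Section Intervals.
Context {R : realType}.
Implicit Types (T S D : bint R) (k : R).

Lemma lo_sum (I : finType) (T : I -> bint R) :
  lo (\sum_i T i) = \sum_i lo (T i).
Proof. exact: (big_morph (@lo R) (fun _ _ => erefl) erefl). Qed.

Lemma lo_scale_ge0 k T : 0 <= k -> lo (bint_scale k T) = k * lo T.
Proof. by move=> k0; apply/min_idPl/ler_wpM2l => //; exact: lo_le_hi. Qed.

Lemma hi_scale_ge0 k T : 0 <= k -> hi (bint_scale k T) = k * hi T.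
Proof. by move=> k0; apply/max_idPr/ler_wpM2l => //; exact: lo_le_hi. Qed.

(** Negation swaps the endpoints, so the bound on the larger endpoint of the
    gH-difference is a lower bound on the smaller endpoint of [T]. *)
Lemma leLU_gHsub_opp T (c : R) :
  leLU (gHsub (bint_opp T) (bint_of c)) (bint_of 0) -> - c <= lo T.
Proof.
case/andP=> _; rewrite [hi (bint_of 0)]/hi [hi (gHsub _ _)]/hi /=.
rewrite ge_max => /andP[_]; rewrite {1}/hi /= [hi (bint_of c)]/hi /= !mulN1r.
rewrite lerBlDr add0r ge_max => /andP[Tc _].
by rewrite lerNl.
Qed.

Lemma ltLU_strict T S : ltLU T S -> lo T < lo S \/ hi T < hi S.
Proof.
case/andP=> /andP[]; rewrite !le_eqVlt.
move=> /predU1P[loTS|]; last by left.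
move=> /predU1P[hiTS|]; last by right.
by rewrite (bint_eqP loTS hiTS) eqxx.
Qed.

End Intervals.

Section Convergence.
Context {R : realType} {I : Type} {F : set_system I} {FF : Filter F}.

Lemma cvg_min (f g : I -> R) (a b : R) : f @ F --> a -> g @ F --> b ->
  Num.min (f x) (g x) @[x --> F] --> Num.min a b.
Proof.
move=> fa gb.
refine (@continuous2_cvg I R R R F _ f g (fun x y => Num.min x y) a b _ fa gb).
exact: (@min_continuous _ R (a, b)).
Qed.

Lemma cvg_max (f g : I -> R) (a b : R) : f @ F --> a -> g @ F --> b ->
  Num.max (f x) (g x) @[x --> F] --> Num.max a b.
Proof.
move=> fa gb.
refine (@continuous2_cvg I R R R F _ f g (fun x y => Num.max x y) a b _ fa gb).
exact: (@max_continuous _ R (a, b)).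
Qed.

(** Reduces limits of intervals to limits of reals: it yields both the
    existence and the uniqueness of the gH-directional derivative. *)
Lemma hausdorff_cvg0P (X : I -> bint R) (D : bint R) :
  hausdorff_dist (X x) D @[x --> F] --> (0 : R) <->
  lo (X x) @[x --> F] --> lo D /\ hi (X x) @[x --> F] --> hi D.
Proof.
split=> [XD|[Xlo Xhi]]; last first.
  rewrite -[0 : R](maxxx 0); apply: cvg_max.
    by apply/norm_cvg0P/subr_cvg0.
  by apply/norm_cvg0P/subr_cvg0.
split; apply/subr_cvg0/norm_cvg0P;
  apply: (squeeze_cvgr _ (cvg_cst 0) XD); apply: nearW => x;
  by rewrite normr_ge0 /hausdorff_dist le_max lexx ?orbT.
Qed.

End Convergence.

Section Derivatives.
Context {R : realType} {n : nat} {H : hadamardManifold R n}.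
Implicit Types (E : set H) (p q : H).

(** For [0 < a <= 1], convexity at [p] reads
    [f (gamma a) <= f p + a * (f q - f p)]; dividing by [a] bounds the
    difference quotient by a constant. *)
Lemma dir_derivative_le_sub E (f : H -> R) p q :
  convex_at E f p -> dir_differentiable f p -> E q ->
  dir_derivative f (rlog p q) <= f q - f p.
Proof.
move=> fcvx fdiff Eq; apply: limr_le; first exact: fdiff.
near=> a; have a0 : 0 < a by near: a; exact: nbhs_right_gt.
have a1 : a <= 1 by near: a; exact: nbhs_right_le.
rewrite /dir_quotient ler_pdivrMr// lerBlDr.
rewrite [leRHS](_ : _ = a * f q + (1 - a) * f p); last by ring.
by apply: fcvx => //; rewrite ltW.
Unshelve. all: by end_near. Qed.

Lemma LU_convex_lo E (f : H -> bint R) p :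
  LU_convex_at E f p -> convex_at E (lo \o f) p.
Proof.
move=> fcvx q t Eq /[dup] t01 /andP[t0 t1].
have /andP[+ _] := fcvx q t Eq t01.
by rewrite [lo (_ + _)]/lo /= !lo_scale_ge0 ?subr_ge0// addrC.
Qed.

Lemma LU_convex_hi E (f : H -> bint R) p :
  LU_convex_at E f p -> convex_at E (hi \o f) p.
Proof.
move=> fcvx q t Eq /[dup] t01 /andP[t0 t1].
have /andP[_] := fcvx q t Eq t01.
by rewrite [hi (_ + _)]/hi /= !hi_scale_ge0 ?subr_ge0// addrC.
Qed.

Lemma is_gH_dir_derivative_unique (f : H -> bint R) p (w : tangent p) D D' :
  is_gH_dir_derivative f w D -> is_gH_dir_derivative f w D' -> D = D'.
Proof.
move=> /hausdorff_cvg0P[lD hD] /hausdorff_cvg0P[lD' hD'].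
apply: bint_eqP; first exact: cvg_unique (@norm_hausdorff _ R^o) _ _ _ _ lD lD'.
exact: cvg_unique (@norm_hausdorff _ R^o) _ _ _ _ hD hD'.
Qed.

(** The scaling by [a^-1 > 0] commutes with the minimum and maximum that form
    the gH-difference. *)
Lemma gH_quotient_endpoints (f : H -> bint R) p (w : tangent p) (a : R) :
  0 < a ->
  lo (gH_quotient f w a) =
    Num.min (dir_quotient (lo \o f) w a) (dir_quotient (hi \o f) w a) /\
  hi (gH_quotient f w a) =
    Num.max (dir_quotient (lo \o f) w a) (dir_quotient (hi \o f) w a).
Proof.
move=> a0; have ai0 : 0 <= a^-1 by rewrite invr_ge0 ltW.
rewrite /gH_quotient lo_scale_ge0// hi_scale_ge0// /dir_quotient.
rewrite [lo (gHsub _ _)]/lo [hi (gHsub _ _)]/hi /=.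
by rewrite -minr_pMl// -maxr_pMl// ![_ * a^-1]mulrC.
Qed.

(** Minimum and maximum are continuous, so they can be taken after the limit. *)
Lemma gH_dir_derivativeE (f : H -> bint R) p (w : tangent p) :
  weakly_dir_differentiable f p ->
  gH_dir_derivative f w =
  Bint (le_min_max (dir_derivative (lo \o f) w) (dir_derivative (hi \o f) w)).
Proof.
move=> [dlo dhi]; set D := Bint _.
suff DP : is_gH_dir_derivative f w D.
  apply: (is_gH_dir_derivative_unique f _ w _ _ _ DP).
  exact: (xgetPex _ (ex_intro _ D DP)).
apply/hausdorff_cvg0P; split.
  apply: cvg_trans (cvg_min _ _ _ _ (dlo w) (dhi w)); apply: near_eq_cvg.
  near=> a; apply/esym; apply: (gH_quotient_endpoints f p w a _).1.
  by near: a; exact: nbhs_right_gt.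
apply: cvg_trans (cvg_max _ _ _ _ (dlo w) (dhi w)); apply: near_eq_cvg.
near=> a; apply/esym; apply: (gH_quotient_endpoints f p w a _).2.
by near: a; exact: nbhs_right_gt.
Unshelve. all: by end_near. Qed.

Lemma lo_gH_dir_derivative_le E (f : H -> bint R) p q :
  LU_convex_at E f p -> weakly_dir_differentiable f p -> E q ->
  lo (gH_dir_derivative f (rlog p q)) <=
  Num.min (lo (f q) - lo (f p)) (hi (f q) - hi (f p)).
Proof.
move=> fcvx /[dup] fd [dlo dhi] Eq; rewrite gH_dir_derivativeE// {1}/lo /=.
rewrite le_min !ge_min; apply/andP; split; apply/orP; [left|right].
  exact: dir_derivative_le_sub (LU_convex_lo _ _ _ fcvx) dlo Eq.
exact: dir_derivative_le_sub (LU_convex_hi _ _ _ fcvx) dhi Eq.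
Qed.

Lemma lo_gH_dir_derivative_le0 E (f : H -> bint R) p q :
  LU_convex_at E f p -> weakly_dir_differentiable f p -> E q ->
  leLU (f q) (f p) -> lo (gH_dir_derivative f (rlog p q)) <= 0.
Proof.
move=> fcvx fd Eq /andP[qp _].
apply: le_trans (lo_gH_dir_derivative_le _ _ _ _ fcvx fd Eq) _.
by rewrite ge_min subr_le0 qp.
Qed.

Lemma lo_gH_dir_derivative_lt0 E (f : H -> bint R) p q :
  LU_convex_at E f p -> weakly_dir_differentiable f p -> E q ->
  ltLU (f q) (f p) -> lo (gH_dir_derivative f (rlog p q)) < 0.
Proof.
move=> fcvx fd Eq /ltLU_strict qp.
apply: le_lt_trans (lo_gH_dir_derivative_le _ _ _ _ fcvx fd Eq) _.
by rewrite gt_min !subr_lt0; apply/orP.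
Qed.

End Derivatives.

Theorem theorem4p1 (R : realType) (n : nat) (H : hadamardManifold R n)
    (E : set H) (l t : nat) (phi : 'I_l -> H -> bint R) (psi : 'I_t -> H -> R)
    (pbar : H) :
  E !=set0 -> open E -> geodesic_convex E ->
  geodesic_convex (feasible_set E psi) ->
  feasible_set E psi pbar ->
  (forall u, convex_at E (psi u) pbar /\ dir_differentiable (psi u) pbar) ->
  (forall s, LU_convex_at E (phi s) pbar /\
             weakly_dir_differentiable (phi s) pbar) ->
  (exists (lambda : 'I_l -> R) (mu : 'I_t -> R),
    [/\ forall s, 0 < lambda s,
        forall u, 0 <= mu u,
        forall p, feasible_set E psi p ->
          leLU
            (gHsub
              (bint_opp (\sum_(s < l) bint_scale (lambda s)
                 (gH_dir_derivative (phi s) (rlog pbar p))))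
              (bint_of (\sum_(u < t)
                 mu u * dir_derivative (psi u) (rlog pbar p))))
            (bint_of 0) &
        forall u, mu u * psi u pbar = 0]) ->
  type_I_Pareto_optimal phi (feasible_set E psi) pbar.
Proof.
move=> _ _ _ _ Fpbar psiP phiP [lambda [mu [lambda0 mu0 stat slack]]].
split=> // -[q Fq [le_q [h lt_q]]]; have [Eq psi_q] := Fq.
have := leLU_gHsub_opp _ _ (stat q Fq); rewrite lo_sum; apply/negP.
rewrite -ltNge; apply: (@lt_le_trans _ _ 0).
  (* The strictly improved objective makes the weighted sum negative. *)
  rewrite (bigD1 h)//= -[ltRHS]addr0; apply: ltr_leD.
    rewrite lo_scale_ge0 ?(ltW (lambda0 _))// pmulr_rlt0//.
    by have [] := phiP h => c d; exact: lo_gH_dir_derivative_lt0 c d Eq lt_q.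
  apply: sumr_le0 => s _.
  rewrite lo_scale_ge0 ?(ltW (lambda0 _))// pmulr_rle0//.
  have [c d] := phiP s; exact: lo_gH_dir_derivative_le0 c d Eq (le_q s).
rewrite oppr_ge0; apply: sumr_le0 => u _.
(* By slackness, mu u * psi u q = mu u * (psi u q - psi u pbar). *)
apply: (@le_trans _ _ (mu u * psi u q)); last exact: mulr_ge0_le0.
have [c d] := psiP u.
rewrite -[leRHS]subr0 -(slack u) -mulrBr ler_wpM2l//.
exact: dir_derivative_le_sub c d Eq.
Qed.
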